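(* For every $n$, there are only finitely many feasible weight vectors in $\mathbb{P}^n$.
   Context: Work over $\mathbb{C}$, with $n\ge 2$. A weight vector in $\mathbb{P}^n$ is a vector of non-negative integers $L=(l_0,\ldots,l_{n-2})$. A configuration of linear spaces of weight $L$ is a union of $l_i$ linear spaces of dimension $i$ in $\mathbb{P}^n$, for $i=0,\ldots,n-2$; it is generic if the tuple of its linear components is chosen in a suitable non-empty Zariski open subset of the corresponding product of Grassmannians. A configuration $\Lambda_1\cup\dots\cup\Lambda_t$ is feasible if there is a rational normal curve $\mathcal{C}\subset\mathbb{P}^n$ (a curve projectively equivalent to the degree $n$ Veronese embedding of $\mathbb{P}^1$) such that the scheme $\mathcal{C}\cap\Lambda_i$ has degree $\dim\Lambda_i+1$ for every component $\Lambda_i$. The weight vector $L$ is feasible if a generic configuration of weight $L$ is feasible. *)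

(* Defs.v *)
From HB Require Import structures.
From mathcomp Require Import all_boot all_order all_algebra.
From mathcomp Require Import complex.
From mathcomp Require Import classical_sets cardinality reals.
From mathcomp Require Import mpoly.

Set Implicit Arguments.
Unset Strict Implicit.
Unset Printing Implicit Defensive.

Import GRing.Theory.
Local Open Scope classical_set_scope.
Local Open Scope ring_scope.

(* Subsets of P^n are represented by their affine cones in F^(n+1); a linear
   subspace of projective dimension i is a vector subspace of dimension i + 1.
   The definitions are meant for an algebraically closed field F. *)

Section ProjectiveSchemes.
Variables (F : fieldType) (n : nat).

(* The degree d part of the homogeneous ideal of the projective variety with
   affine cone X. *)
Definition vanishing_forms (X : set 'rV[F]_n.+1) (d : nat) :
    set (dhomog n.+1 F d) :=
  [set f | forall x, X x -> (val f).@[fun j => x 0 j] = 0].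

(* The degree d part of I(X) + I(Y), which cuts out the scheme-theoretic
   intersection of the varieties X and Y. *)
Definition intersection_forms (X Y : set 'rV[F]_n.+1) (d : nat) :
    set (dhomog n.+1 F d) :=
  [set f | exists p q,
     [/\ vanishing_forms X p, vanishing_forms Y q & f = p + q]].

(* The scheme-theoretic intersection of X and Y is zero-dimensional (or empty)
   of degree k: its Hilbert polynomial is the constant k, that is, (I(X) + I(Y))_d
   has codimension k in the space of all forms of degree d for all large d. *)
Definition intersection_has_degree (X Y : set 'rV[F]_n.+1) (k : nat) : Prop :=
  exists d0 : nat, forall d : nat, (d0 <= d)%N ->
    exists V : {vspace dhomog n.+1 F d},
      (forall f, f \in V <-> @intersection_forms X Y d f) /\
      (\dim V + k)%N = \dim {: dhomog n.+1 F d}.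

Definition veronese (s t : F) : 'rV[F]_n.+1 :=
  \row_(i < n.+1) (s ^+ (n - i) * t ^+ i).

Definition rational_normal_curve (C : set 'rV[F]_n.+1) : Prop :=
  exists2 A : 'M[F]_n.+1, A \in unitmx &
    C = [set x | exists c s t, x = c *: (veronese s t *m A)].

End ProjectiveSchemes.

(* The i-th entry, for i = 0, ..., n-2, is the number of components of
   projective dimension i. *)
Definition weight (n : nat) := {ffun 'I_n.-1 -> nat}.

Section Configurations.
Variables (F : fieldType) (n : nat).

Definition grassmannian (i : nat) :=
  {W : {vspace 'rV[F]_n.+1} | \dim W == i.+1}.

Definition component (L : weight n) : finType := {i : 'I_n.-1 & 'I_(L i)}.

Definition configuration (L : weight n) :=
  forall c : component L, grassmannian (tag c).

Definition feasible_configuration (L : weight n) (Lam : configuration L) :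
    Prop :=
  exists2 C : set 'rV[F]_n.+1, rational_normal_curve C &
    forall c : component L,
      intersection_has_degree C [set x | x \in val (Lam c)] (tag c).+1.

Definition frames (L : weight n) :=
  forall c : component L, (tag c).+1.-tuple 'rV[F]_n.+1.

Definition frame_of (L : weight n) (Lam : configuration L) (v : frames L) :
    Prop :=
  forall c, basis_of (val (Lam c)) (v c).

(* The index of an entry in a family of frames: component, row and column. *)
Definition entry (L : weight n) : finType :=
  {c : component L & ('I_(tag c).+1 * 'I_n.+1)%type}.

Definition entries (L : weight n) (v : frames L) (e : 'I_#|entry L|) : F :=
  let u := enum_val e in (tnth (v (tag u)) (tagged u).1) 0 (tagged u).2.

(* Gr(k, n+1) is the quotient by GL_k of the open subset of matrices of full
   rank in the affine space of k x (n+1) matrices, and similarly for products.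
   Accordingly U is open when its preimage in the space of families of frames
   is the complement of the common zeros of a set P of polynomials. *)
Definition zariski_open (L : weight n) (U : set (configuration L)) : Prop :=
  exists P : set {mpoly F[#|entry L|]},
    forall (Lam : configuration L) (v : frames L), frame_of Lam v ->
      (U Lam <-> exists2 p, P p & p.@[entries v] != 0).

Definition feasible_weight (L : weight n) : Prop :=
  exists U : set (configuration L),
    [/\ zariski_open U, U !=set0 & U `<=` @feasible_configuration L].

End Configurations.

(* Main.v *)
(* A feasible component meets the curve: otherwise its linear equations
   restrict to binary forms without common zero, which by Bezout generate all
   binary forms of large degree, so the intersection scheme is empty. A linear
   space of dimension at most n - 2 meeting a given curve satisfies at least one
   condition, whereas the curves depend on at most (n + 1)^2 parameters. So the
   frames of feasible configurations with more than (n + 1)^2 components are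
   covered by finitely many polynomial images of affine spaces of smaller
   dimension, and satisfy a nontrivial polynomial relation. *)
Require Import Defs.
From mathcomp Require Import all_boot all_order all_algebra.
From mathcomp Require Import complex.
From mathcomp Require Import classical_sets cardinality reals.
From mathcomp Require Import mpoly zify boolp.

Set Implicit Arguments.
Unset Strict Implicit.
Unset Printing Implicit Defensive.

Import GRing.Theory.
Local Open Scope ring_scope.

Local Notation widen := (widen_ord (leqnSn _)).

(** * Multivariate polynomials: nonvanishing points and algebraic dependence *)

Lemma meval_muni (R : comNzRingType) (k : nat) (p : {mpoly R[k.+1]})
    (w : 'I_k.+1 -> R) :
  p.@[w] = (map_poly (meval (fun i => w (widen i))) (muni p)).[w ord_max].
Proof.
rewrite mevalE muniE rmorph_sum horner_sum; apply: eq_bigr => m _ /=.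
rewrite -mul_polyC rmorphM /= map_polyC map_polyXn /= mevalZ mevalX.
rewrite !hornerE big_ord_recr /= mulrA; congr (_ * _ * _).
by apply: eq_bigr => i _; rewrite mnmE.
Qed.

(** No coefficient is lost: that of [m] in [p] reappears in [muni p], in front of the power
    [m ord_max], at the monomial formed by the other exponents. *)
Lemma muni_eq0 (R : comNzRingType) (k : nat) (p : {mpoly R[k.+1]}) :
  (muni p == 0) = (p == 0).
Proof.
apply/eqP/eqP => [p0|->]; last by rewrite muni0.
apply/mpolyP => m; rewrite mcoeff0; apply: contraTeq isT => pm.
have := congr1 (fun q : {poly {mpoly R[k]}} =>
  (q`_(m ord_max))@_[multinom m (widen i) | i < k]) p0.
rewrite /= muniE coef0 mcoeff0 coef_sum raddf_sum /=.
rewrite (bigD1_seq m) ?msupp_uniq ?mcoeff_msupp //=.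
rewrite coefZ coefXn eqxx mulr1 mcoeffZ mcoeffX eqxx mulr1.
rewrite big1 ?addr0 => [pm0|m' m'm]; first by rewrite pm0 eqxx in pm.
rewrite coefZ coefXn; case: eqP => [mm|]; last by rewrite mulr0 mcoeff0.
rewrite mulr1 mcoeffZ mcoeffX; case: eqP => [/mnmP mm2|]; last by rewrite mulr0.
case/eqP: m'm; apply/mnmP => i; case: (unliftP ord_max i) => [j ->|->] //.
have := mm2 j; rewrite !mnmE; congr (m' _ = m _).
  by apply: val_inj; rewrite /= /bump leqNgt ltn_ord.
by apply: val_inj; rewrite /= /bump leqNgt ltn_ord.
Qed.

(** Induction on the number of variables: the leading coefficient in the last variable is nonzero at
    some [w'], and the univariate polynomial left at [w'] then has a nonroot. *)
Lemma mpoly_nonroot (F : closedFieldType) (k : nat) (p : {mpoly F[k]}) :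
  p != 0 -> exists w, p.@[w] != 0.
Proof.
elim: k p => [|k IHk] p p0.
  exists (fun=> 0); move: p0; rewrite (nvar0_mpolyC p).
  by rewrite mevalC mpolyC_eq0.
have : lead_coef (muni p) != 0 by rewrite lead_coef_eq0 muni_eq0.
case/IHk => w' pw'.
have : map_poly (meval w') (muni p) != 0.
  apply: contra_neq pw'.
  move=> /(congr1 (fun q : {poly F} => q`_(size (muni p)).-1)).
  by rewrite coef_map coef0.
case/closed_nonrootP => x px.
exists (fun i => oapp w' x (unlift ord_max i)).
rewrite meval_muni unlift_none /=.
rewrite (_ : map_poly _ _ = map_poly (meval w') (muni p)) //.
apply: eq_map_poly => q; apply: meval_eq => i.
rewrite (_ : widen i = lift ord_max i) ?liftK //.
by apply: val_inj; rewrite /= /bump leqNgt ltn_ord.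
Qed.

(* The m ^ b monomials of degree less than m in each of the f i are polynomials
   of degree less than m * B, which have at most (m * B) ^ a coefficients. This
   is less than m ^ b once m > B ^ a. *)
Lemma alg_dependence (F : fieldType) (a b : nat) (f : 'I_b -> {mpoly F[a]}) :
  (a < b)%N ->
  exists2 Q : {mpoly F[b]}, Q != 0 & forall w, Q.@[fun i => (f i).@[w]] = 0.
Proof.
move=> ab; pose D := (\max_i msize (f i))%N.
pose B := (b * D).+1; pose m := (B ^ a).+1; pose K := (m * B)%N.
pose g (e : {ffun 'I_b -> 'I_m}) : {mpoly F[a]} := \prod_i f i ^+ e i.
have msizeM_leS (p q : {mpoly F[a]}) s t :
    (msize p <= s.+1 -> msize q <= t.+1 -> msize (p * q) <= (s + t).+1)%N.
  have [->|p0] := eqVneq p 0; first by rewrite mul0r msize0.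
  have [->|q0] := eqVneq q 0; first by rewrite mulr0 msize0.
  by rewrite msizeM //; move: (msize p) (msize q) => x y; lia.
have gK e : (msize (g e) <= K)%N.
  have : (msize (g e) <= (\sum_(i < b) D * m).+1)%N.
    rewrite /g; elim/big_ind2: _ => [|p1 s1 p2 s2|i _]; first by rewrite msize1.
      exact: msizeM_leS.
    apply: (@leq_trans (D * e i).+1); last by rewrite ltnS leq_mul // ltnW.
    elim: (e i : nat) => [|k IHk]; first by rewrite expr0 msize1.
    by rewrite exprS mulnS msizeM_leS // ltnW // ltnS; apply: (leq_bigmax i).
  by rewrite sum_nat_const card_ord => /leq_trans; apply; rewrite /K /B; lia.
pose M : 'M[F]_(#|{ffun 'I_b -> 'I_m}|, #|{ffun 'I_a -> 'I_K}|) :=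
  \matrix_(e, e') (g (enum_val e))@_[multinom
    (enum_val e' : {ffun 'I_a -> 'I_K}) i : nat | i < a].
have : (0 < \rank (kermx M))%N.
  rewrite mxrank_ker subn_gt0 (leq_ltn_trans (rank_leq_col M)) //.
  rewrite !card_ffun !card_ord.
  rewrite (@leq_trans (m ^ a.+1)) ?leq_pexp2l // /K expnMn expnS mulnC.
  by rewrite ltn_pmul2r ?expn_gt0.
rewrite lt0n mxrank_eq0 => /rowV0Pn[u /sub_kermxP uM u0].
pose mon (e : {ffun 'I_b -> 'I_m}) : 'X_{1..b} := [multinom e i : nat | i < b].
pose Q : {mpoly F[b]} := \sum_e u 0 (enum_rank e) *: 'X_[mon e].
exists Q.
  apply: contra_neq u0 => Q0; apply/rowP => k; rewrite mxE.
  have := congr1 (mcoeff (mon (enum_val k))) Q0.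
  rewrite mcoeff0 raddf_sum (bigD1 (enum_val k)) //= enum_valK.
  rewrite mcoeffZ mcoeffX eqxx mulr1 big1 ?addr0 // => e ek.
  rewrite mcoeffZ mcoeffX; case: eqP => [/mnmP eqe|]; last by rewrite mulr0.
  case/eqP: ek; apply/ffunP => i; apply: val_inj.
  by have := eqe i; rewrite !mnmE.
have Qf : \sum_e u 0 (enum_rank e) *: g e = 0.
  apply/mpolyP => mm; rewrite mcoeff0 raddf_sum /=.
  (* Monomials of degree at least [K] occur in no [g e]; each of the others indexes a column of [M],
     where [u *m M = 0] applies. *)
  have [small|big] := ltnP (mdeg mm) K; last first.
    rewrite big1 // => e _; rewrite mcoeffZ memN_msupp_eq0 ?mulr0 //.
    exact/msize_mdeg_ge/(leq_trans (gK e)).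
  have mmK i : (mm i < K)%N.
    by rewrite (leq_ltn_trans _ small) // mdegE (bigD1 i) //= leq_addr.
  pose e' : {ffun 'I_a -> 'I_K} := [ffun i => Ordinal (mmK i)].
  have := congr1 (fun v : 'rV_ _ => v 0 (enum_rank e')) uM.
  rewrite !mxE => uMe; rewrite -[RHS]uMe.
  rewrite (reindex_onto (@enum_val _ _) (@enum_rank _)) /=; last first.
    by move=> e _; rewrite enum_rankK.
  apply: eq_big => [k|k _]; first by rewrite enum_valK eqxx.
  rewrite mcoeffZ mxE enum_valK enum_rankK; congr (_ * _@__).
  by apply/mnmP => i; rewrite mnmE ffunE.
move=> w; rewrite -[RHS](meval0 w) -Qf !raddf_sum /=; apply: eq_bigr => e _.
rewrite !mevalZ mevalX rmorph_prod; congr (_ * _); apply: eq_bigr => i _.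
by rewrite mnmE rmorphXn.
Qed.

(** * Bezout identities for univariate polynomials, with degree bounds *)

Lemma bezout_family (F : fieldType) (r : nat) (h : 'I_r -> {poly F}) :
  exists u : 'I_r -> {poly F}, forall j, \sum_i u i * h i %| h j.
Proof.
elim: r h => [|r IHr] h; first by exists (fun=> 0); case.
have [u uP] := IHr (fun i => h (lift ord0 i)).
have [[a b] /= abP] := Bezoutp (h ord0) (\sum_i u i * h (lift ord0 i)).
exists (fun i => oapp (fun k => b * u k) a (unlift ord0 i)) => j.
rewrite big_ord_recl unlift_none /=.
under eq_bigr do rewrite liftK /= -mulrA.
rewrite -mulr_sumr (eqp_dvdl _ abP).
case: (unliftP ord0 j) => [k ->|->]; last exact: dvdp_gcdl.
exact: dvdp_trans (dvdp_gcdr _ _) (uP k).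
Qed.

(* The forms of degree n with dehomogenizations [h j] have no common zero on
   P^1: one of them has degree exactly n, so none is at infinity. *)
Lemma bezout_bounded (F : fieldType) (n r e : nat) (h u : 'I_r -> {poly F})
    (j0 : 'I_r) (f : {poly F}) :
  (forall j, size (h j) <= n.+1)%N -> size (h j0) = n.+1 ->
  \sum_j u j * h j = 1 -> (0 < e)%N -> (size f <= (n * e.+1).+1)%N ->
  exists2 g : 'I_r -> {poly F},
    forall j, (size (g j) <= (n * e).+1)%N & f = \sum_j g j * h j.
Proof.
move=> sh sh0 uh e0; have ne := leq_pmulr n e0; rewrite mulnS => sf.
have h0 : h j0 != 0 by rewrite -size_poly_eq0 sh0.
(* Reducing the coefficients [f * u j] modulo [h j0] makes them small; all the quotients are
   collected in the coefficient [w] of [h j0]. *)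
pose rem j := (f * u j) %% h j0.
pose w := \sum_j (f * u j) %/ h j0 * h j.
have fE : f = w * h j0 + \sum_j rem j * h j.
  rewrite mulr_suml -big_split /= -[LHS]mulr1 -uh mulr_sumr.
  apply: eq_bigr => j _; rewrite mulrA {1}(divp_eq (f * u j) (h j0)) mulrDl.
  by congr (_ + _); rewrite -!mulrA [h j0 * _]mulrC.
have srem j : (size (rem j) <= n)%N.
  by rewrite -ltnS -sh0 ltn_modpN0.
(* The product [w * h j0] has degree at most [n + n * e], and [h j0] has degree exactly [n]. *)
have sw : (size w <= (n * e).+1)%N.
  have [->|w0] := eqVneq w 0; first by rewrite size_poly0.
  have : (size (w * h j0)%R <= (n + n * e).+1)%N.
    rewrite (_ : w * h j0 = f - \sum_j rem j * h j); last first.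
      by rewrite fE addrK.
    rewrite (leq_trans (size_polyD _ _)) // geq_max sf size_polyN.
    rewrite (leq_trans (size_sum _ _ _)) //; apply/bigmax_leqP => j _.
    rewrite (leq_trans (size_polyMleq _ _)) //.
    move: (srem j) (sh j) ne; move: (size _) (size _) (n * e)%N; lia.
  rewrite size_mul // sh0; move: (size w) (n * e)%N; lia.
exists (fun j => rem j + (if j == j0 then w else 0)) => [j|].
  rewrite (leq_trans (size_polyD _ _)) // geq_max; apply/andP; split.
    by rewrite (leq_trans (srem j)) // leqW.
  by case: ifP; rewrite ?size_poly0.
under eq_bigr do rewrite mulrDl.
rewrite big_split /= addrC [X in X + _](bigD1 j0) //= eqxx.
by rewrite [X in _ + X + _]big1 ?addr0 // => j /negPf->; rewrite mul0r.
Qed.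

(** * Forms on projective space and their restriction to a rational normal curve *)

Section Forms.
Variables (F : fieldType) (n : nat).

Lemma meval_dhomogZ (k d : nat) (f : {mpoly F[k]}) (c : F) (x : 'I_k -> F) :
  f \is d.-homog -> f.@[fun j => c * x j] = c ^+ d * f.@[x].
Proof.
move=> /dhomogP fd; rewrite !mevalE mulr_sumr big_seq [RHS]big_seq.
apply: eq_bigr => m /fd <-; rewrite mulrCA; congr (_ * _).
rewrite /= mdegE -prodrXr -big_split; apply: eq_bigr => i _ /=.
by rewrite exprMn.
Qed.

Lemma horner_mmap (k : nat) (f : {mpoly F[k]}) (c : 'I_k -> {poly F}) t :
  (mmap polyC c f).[t] = f.@[fun j => (c j).[t]].
Proof.
rewrite mevalE horner_sum; apply: eq_bigr => m _.
rewrite hornerM hornerC /mmap1 horner_prod; congr (_ * _).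
by apply: eq_bigr => i _; rewrite horner_exp.
Qed.

Lemma size_mmap (k d : nat) (f : {mpoly F[k]}) (c : 'I_k -> {poly F}) :
  f \is d.-homog -> (forall j, size (c j) <= n.+1)%N ->
  (size (mmap polyC c f) <= (n * d).+1)%N.
Proof.
move=> /dhomogP fd cn.
have sM (p q : {poly F}) s t :
    (size p <= s.+1 -> size q <= t.+1 -> size (p * q)%R <= (s + t).+1)%N.
  by have := size_polyMleq p q; lia.
rewrite /mmap big_seq (leq_trans (size_sum _ _ _)) //.
apply/bigmax_leqP_seq => m _.
move=> /fd md; rewrite mul_polyC (leq_trans (size_scale_leq _ _)) //.
rewrite -md /= mdegE big_distrr /= /mmap1.
elim/big_ind2: _ => [|p1 s1 p2 s2|i _]; [by rewrite size_poly1|exact: sM|].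
elim: (m i) => [|l IHl]; first by rewrite expr0 size_poly1.
by rewrite exprS mulnS sM.
Qed.

Lemma dhomogMS (k e : nat) (p q : {mpoly F[k]}) :
  p \is e.-homog -> q \is 1.-homog -> p * q \is (e.+1).-homog.
Proof. by move=> pe q1; have := dhomogM pe q1; rewrite addn1. Qed.

Definition linear_form (u : 'cV[F]_n.+1) : {mpoly F[n.+1]} :=
  \sum_j u j 0 *: 'X_j.

Lemma linear_form_homog u : linear_form u \is 1.-homog.
Proof. by apply: rpred_sum => j _; rewrite rpredZ // dhomogX /= mdeg1. Qed.

Lemma meval_linear_form u (x : 'rV[F]_n.+1) :
  (linear_form u).@[fun j => x 0 j] = (x *m u) 0 0.
Proof.
rewrite raddf_sum mxE; apply: eq_bigr => j _ /=.
by rewrite mevalZ mevalXU mulrC.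
Qed.

Definition curve_point (A : 'M[F]_n.+1) (s t : F) (j : 'I_n.+1) : F :=
  (veronese n s t *m A) 0 j.

Lemma horner_curve_l (A : 'M[F]_n.+1) j t :
  (\poly_(i < n.+1) A (inord i) j).[t] = curve_point A 1 t j.
Proof.
rewrite horner_poly /curve_point mxE; apply: eq_bigr => i _.
by rewrite !mxE expr1n mul1r inord_val mulrC.
Qed.

Lemma veronese_scale (s t : F) : s != 0 ->
  veronese n s t = s ^+ n *: veronese n 1 (t / s).
Proof.
move=> s0; apply/rowP => i; rewrite !mxE expr1n mul1r expr_div_n.
rewrite expfB_cond ?(negPf s0) ?add0n -1?ltnS //.
by rewrite [in RHS]mulrCA mulrC.
Qed.

(** The linear forms [y i] obtained from the inverse of [A] restrict to [t ^+ i]. Induction on [e]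
    splits [g] at degree [n]: the upper part is a multiple of [t ^+ n], the restriction of
    [y ord_max], and the lower part is a linear form times [y ord0 ^+ e], which restricts to 1. *)
Lemma form_of_poly (A : 'M[F]_n.+1) (e : nat) (g : {poly F}) :
  A \in unitmx -> (size g <= (n * e).+1)%N ->
  exists2 G : {mpoly F[n.+1]}, G \is e.-homog &
    forall t, G.@[curve_point A 1 t] = g.[t].
Proof.
move=> uA; pose y i := linear_form (col i (invmx A)).
have yh i : y i \is 1.-homog by exact: linear_form_homog.
have yE i t : (y i).@[curve_point A 1 t] = t ^+ i.
  rewrite meval_linear_form colE !mulmxA mulmxK // -colE !mxE.
  by rewrite expr1n mul1r.
elim: e g => [|e IHe] g.
  rewrite muln0 => /size1_polyC ->; exists (g`_0)%:MP => [|t].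
    by rewrite -[_%:MP]mulr1 mul_mpolyC rpredZ ?dhomog1.
  by rewrite mevalC hornerC.
rewrite mulnS => sg.
have [|G Gh GE] := IHe (drop_poly n g).
  by rewrite size_drop_poly leq_subLR addnS.
exists (G * y ord_max + y ord0 ^+ e * \sum_(i < n) g`_i *: y (inord i)) => [|t].
  rewrite rpredD ?dhomogMS // ?rpred_sum // => [|i _]; last by rewrite rpredZ.
  by have := dhomogMn e (yh ord0); rewrite mul1n.
rewrite mevalD !mevalM rmorphXn /= !yE expr0 expr1n mul1r GE.
rewrite -[g in RHS](poly_take_drop n) hornerD hornerM hornerXn addrC.
congr (_ + _); rewrite raddf_sum [RHS]horner_poly; apply: eq_bigr => i _ /=.
by rewrite mevalZ yE inordK // ltnS ltnW.
Qed.

Lemma subspace_equations (W : {vspace 'rV[F]_n.+1}) :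
  exists K : 'M[F]_n.+1, forall x, (x \in W) = (x *m K == 0).
Proof.
exists (lin1_mx (\1 - projv W)%VF) => x.
rewrite mul_rV_lin1 /= add_lfunE opp_lfunE id_lfunE subr_eq0 eq_sym.
by apply/idP/eqP => [/projv_id|<-] //; exact: memv_proj.
Qed.

End Forms.

(** Homogeneity gives the points with [s != 0]. For fixed [t] the value is a polynomial in [s], so
    it also vanishes at [s = 0]. *)
Lemma vanish_on_curve (F : closedFieldType) (n d : nat) (A : 'M[F]_n.+1)
    (f : {mpoly F[n.+1]}) :
  f \is d.-homog -> (forall t, f.@[curve_point A 1 t] = 0) ->
  forall c s t : F, f.@[fun j => (c *: (veronese n s t *m A)) 0 j] = 0.
Proof.
move=> fd f0 c s t.
have fs s' : s' != 0 -> f.@[curve_point A s' t] = 0.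
  move=> s'0; rewrite -(mulr0 (s' ^+ n ^+ d)) -(f0 (t / s')) -meval_dhomogZ //.
  apply: meval_eq => j.
  by rewrite /curve_point veronese_scale // -scalemxAl mxE.
pose P := mmap polyC
  (fun j => \sum_(i < n.+1) (t ^+ i * A i j) *: 'X^(n - i)) f.
have PE s' : P.[s'] = f.@[curve_point A s' t].
  rewrite horner_mmap; apply: meval_eq => j.
  rewrite horner_sum [RHS]mxE; apply: eq_bigr => i _.
  by rewrite hornerZ hornerXn mxE mulrC mulrA.
have P0 : P = 0.
  (* The factor ['X] forces a nonroot of the product to be nonzero, where [P] is known to vanish. *)
  have : P * 'X == 0.
    apply/negPn/negP => /closed_nonrootP[z].
    rewrite rootM rootX negb_or rootE PE => /andP[fz z0].
    by rewrite fs ?eqxx in fz.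
  by rewrite mulf_eq0 polyX_eq0 orbF => /eqP.
rewrite -(mulr0 (c ^+ d)) -(horner0 s) -P0 PE -meval_dhomogZ //.
by apply: meval_eq => j; rewrite mxE.
Qed.

Lemma curve_meets_subspace (F : closedFieldType) (n k : nat) (A : 'M[F]_n.+1)
    (W : {vspace 'rV[F]_n.+1}) :
  A \in unitmx ->
  intersection_has_degree [set x | exists c s t, x = c *: (veronese n s t *m A)]
    [set x | x \in W] k.+1 ->
  exists s t, (s, t) != (0, 0) /\ veronese n s t *m A \in W.
Proof.
(* The degree [d0.+2] lies in the range of the hypothesis and is [e.+1] with [0 < e], as
   [bezout_bounded] requires. *)
move=> uA [d0 /(_ d0.+2 (leqW (leqnSn _)))[V [VE dimV]]].
have [K KE] := subspace_equations W.
pose h (j : 'I_n.+1) : {poly F} := \poly_(i < n.+1) (A *m K) (inord i) j.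
have sh j : (size (h j) <= n.+1)%N by exact: size_poly.
have hE j t : (h j).[t] = (veronese n 1 t *m A *m K) 0 j.
  by rewrite horner_curve_l /curve_point mulmxA.
(* Either the point [(0, 1)] at infinity of the curve lies in [W], or some [h j0] has degree exactly
   [n]. *)
have [inf|fin] := boolP [forall j, (A *m K) ord_max j == 0].
  exists 0, 1; split; first by rewrite xpair_eqE oner_eq0 andbF.
  rewrite KE -mulmxA; apply/eqP/rowP => j; rewrite !mxE big_ord_recr /=.
  rewrite (eqP (forallP inf j)) mulr0 addr0 big1 // => i _.
  by rewrite mxE /= expr0n subn_eq0 leqNgt ltn_ord !mul0r.
have [j0 hj0] : exists j0, size (h j0) = n.+1.
  case/forallPn: fin => j0 hj0; exists j0; apply: size_poly_eq.
  by rewrite (_ : inord n = ord_max) //; apply: val_inj; rewrite /= inordK.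
have [u uP] := bezout_family h.
(* The combination is a gcd of the [h j]: if it is not a nonzero constant, it has a root, which is a
   common zero. *)
have [g1|g1] := boolP (size (\sum_i u i * h i)%R == 1); last first.
  case/closed_rootP: g1 => t t0; exists 1, t.
  split; first by rewrite xpair_eqE oner_eq0.
  rewrite KE; apply/eqP/rowP => j; rewrite -hE mxE; apply/rootP.
  by move: t0; rewrite -!dvdp_XsubCl => /dvdp_trans; apply; exact: uP.
exfalso; have /size_poly1P[c c0 gc] := g1.
pose u' i := c^-1 *: u i.
have u'1 : \sum_i u' i * h i = 1.
  under eq_bigr do rewrite -scalerAl.
  by rewrite -scaler_sumr gc -mul_polyC -polyCM mulVf.
(* Then [V] would have codimension 0 instead of [k.+1]. *)
suff VT : V = fullv by move: dimV; rewrite VT -[RHS]addn0 => /addnI.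
apply/vspaceP => f; rewrite memvf; apply/VE.
pose phi := mmap polyC (fun j => \poly_(i < n.+1) A (inord i) j) (val f).
have phiE t : phi.[t] = (val f).@[curve_point A 1 t].
  by rewrite horner_mmap; apply: meval_eq => j; exact: horner_curve_l.
have sphi : (size phi <= (n * d0.+2).+1)%N.
  by apply: size_mmap => [|j]; [exact: dhomog_is_dhomog|exact: size_poly].
have [g sg gE] := bezout_bounded sh hj0 u'1 (ltn0Sn d0) sphi.
have /fin_all_exists2[G Gh GE] j := form_of_poly uA (sg j).
pose q := \sum_j G j * linear_form (col j K).
have qh : q \is d0.+2.-homog.
  by apply: rpred_sum => j _; rewrite dhomogMS ?linear_form_homog.
have pE : val f - q \is d0.+2.-homog by rewrite rpredB ?dhomog_is_dhomog.
(* The form [q] vanishes on [W] and agrees with [f] on the curve. *)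
exists (DHomog pE), (DHomog qh); split.
- move=> x [c1 [s [t ->]]] /=; apply: vanish_on_curve pE _ c1 s t => t1.
  rewrite mevalB -phiE gE horner_sum (raddf_sum (meval _)) -sumrB.
  rewrite big1 // => j _ /=.
  rewrite mevalM GE hornerM hE meval_linear_form colE mulmxA -colE !mxE.
  exact: subrr.
- move=> x; rewrite /= KE => /eqP xK; rewrite raddf_sum big1 // => j _ /=.
  by rewrite mevalM meval_linear_form colE mulmxA xK mul0mx mxE mulr0.
- by apply: val_inj; rewrite /= subrK.
Qed.

Lemma card_Tagged (I : finType) (T : I -> finType) :
  #|{: {i : I & T i}}| = (\sum_i #|T i|)%N.
Proof. by rewrite card_tagged sumnE big_map big_enum. Qed.

(** * Parametrization of the feasible frames and the dimension count *)

Section Charts.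
Variables (F : closedFieldType) (n : nat) (L : weight n).
Hypothesis n2 : (2 <= n)%N.

(* The chart [J] parametrizes the families of frames such that each component
   [c] contains a point x of the curve whose coordinate on the [J c]-th vector
   of the frame is nonzero. This vector is then a combination of x and of the
   other vectors. The coordinates are the matrix of the curve and, for each
   component, the other vectors, the coefficients, and the homogeneous
   coordinates (s, t) of the point, which absorb the coefficient of x. *)
Definition chart_coord : finType :=
  (('I_n.+1 * 'I_n.+1) +
   {c : component L & ('I_(tag c) * 'I_n.+1 + 'I_(tag c) + bool)%type})%type.

(** The ring is arbitrary so that the same formula gives polynomials, when applied to variables, and
    their values, when applied to points. *)
Definition chart (S : comPzRingType) (J : forall c : component L, 'I_(tag c).+1)
    (x : chart_coord -> S) (e : entry L) : S :=
  let: existT c (r, k) := e in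
  let y q := x (inr (existT _ c q)) in
  if unlift (J c) r is Some l then y (inl (inl (l, k))) else
  \sum_(i < n.+1)
    y (inr false) ^+ (n - i) * y (inr true) ^+ i * x (inl (i, k)) +
  \sum_l y (inl (inr l)) * y (inl (inl (l, k))).

Lemma rmorph_chart (S S' : comPzRingType) (f : {rmorphism S -> S'}) J x e :
  f (chart J x e) = chart J (f \o x) e.
Proof.
case: e => c [r k]; rewrite /chart; case: unlift => //=.
rewrite rmorphD !rmorph_sum; congr (_ + _); apply: eq_bigr => i _.
  by rewrite !rmorphM !rmorphXn.
by rewrite rmorphM.
Qed.

(** A component of dimension [i] has [(i + 1)(n + 1)] entries but [i (n + 1) + i + 2] coordinates of
    its own, which is fewer since [i <= n - 2]. One saved per component outweighs the matrix of the
    curve. *)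
Lemma card_chart_coord :
  (n.+1 ^ 2 < #|component L| -> #|chart_coord| < #|entry L|)%N.
Proof.
move=> N; rewrite card_sum !card_Tagged card_prod !card_ord.
apply: (@leq_trans (#|component L| + \sum_(c : component L)
   #|{: 'I_(tag c) * 'I_n.+1 + 'I_(tag c) + bool}|)).
  by rewrite -addSn leq_add2r.
rewrite -sum1_card -big_split leq_sum // => c _.
rewrite !card_sum !card_prod !card_ord card_bool.
by have := ltn_ord (tag c); move: (tag c : nat) n2 => /=; lia.
Qed.

Lemma veronese_neq0 (s t : F) : (s, t) != (0, 0) -> veronese n s t != 0.
Proof.
apply: contra_neq => /rowP v0; congr (_, _).
  have := v0 ord0; rewrite !mxE expr0 mulr1 subn0 => /eqP.
  by rewrite expf_eq0 => /andP[_ /eqP].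
have := v0 ord_max; rewrite !mxE subnn mul1r => /eqP.
by rewrite expf_eq0 => /andP[_ /eqP].
Qed.

Lemma exists_root_of (a : F) : exists b, b ^+ n = a.
Proof.
have : size ('X^n - a%:P) != 1 by rewrite size_XnsubC; case: n n2.
by case/closed_rootP => b; rewrite rootE !hornerE subr_eq0 => /eqP; exists b.
Qed.

Lemma feasible_in_chart (Lam : configuration F L) (v : frames F L) :
  feasible_configuration Lam -> frame_of Lam v ->
  exists J x, forall c r k, tnth (v c) r 0 k = chart J x (existT _ c (r, k)).
Proof.
move=> [C [A uA ->] meets] vP.
have /fin_all_exists[u uP] (c : component L) :
    exists u : 'I_(tag c).+1 * (F * F * ('I_(tag c) -> F)),
      tnth (v c) u.1 = veronese n u.2.1.1 u.2.1.2 *m A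
        + \sum_l u.2.2 l *: tnth (v c) (lift u.1 l).
  have [s [t [st xW]]] := curve_meets_subspace uA (meets c).
  set x := _ *m A in xW; have x0 : x != 0.
    apply: contra_neq (veronese_neq0 st) => x0.
    by rewrite -(mulmxK uA (veronese n s t)) -/x x0 mul0mx.
  have [a xE] : exists a : 'I_(tag c).+1 -> F, x = \sum_r a r *: tnth (v c) r.
    exists (fun r => coord (v c) r x); rewrite {1}(coord_basis (vP c) xW).
    by apply: eq_bigr => r _; rewrite -tnth_nth.
  have /existsP[r ar] : [exists r, a r != 0].
    apply: contraNT x0; rewrite negb_exists => /forallP a0.
    by rewrite xE big1 // => r _; rewrite (eqP (negPn (a0 r))) scale0r.
  (* Scaling [(s, t)] by [b] scales the point by [b ^+ n], which brings its coefficient on the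
     [r]-th vector to 1. *)
  have [b bE] := exists_root_of (a r)^-1.
  exists (r, (b * s, b * t, fun l => - ((a r)^-1 * a (lift r l)))) => /=.
  have -> : veronese n (b * s) (b * t) = (a r)^-1 *: veronese n s t.
    apply/rowP => i; rewrite !mxE -bE !exprMn mulrACA -exprD subnK //.
    by rewrite -ltnS.
  rewrite -scalemxAl -/x; under eq_bigr do rewrite scaleNr -scalerA.
  rewrite sumrN -scaler_sumr -scalerBr; apply: (scalerI ar).
  by rewrite scalerA divff // scale1r xE (bigD1_ord r) //= addrK.
exists (fun c => (u c).1), (fun p => match p with
  | inl (i, k) => A i k
  | inr (existT c (inl (inl (l, k)))) => tnth (v c) (lift (u c).1 l) 0 k
  | inr (existT c (inl (inr l))) => (u c).2.2 l
  | inr (existT c (inr b)) => if b then (u c).2.1.2 else (u c).2.1.1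
  end) => c r k; rewrite /chart.
case: unliftP => [l ->|->] //; rewrite uP !mxE summxE.
by congr (_ + _); apply: eq_bigr => i _; rewrite mxE.
Qed.

Lemma feasible_relation : (n.+1 ^ 2 < #|component L|)%N ->
  exists2 Q : {mpoly F[#|entry L|]}, Q != 0 &
    forall (Lam : configuration F L) (v : frames F L),
      feasible_configuration Lam -> frame_of Lam v -> Q.@[entries v] = 0.
Proof.
move=> /card_chart_coord lt_coord.
pose charts := {dffun forall c : component L, 'I_(tag c).+1}.
have /fin_all_exists2[Q Q0 QE] (J : charts) := alg_dependence
  (fun e => chart J (fun p => 'X_(enum_rank p) : {mpoly F[_]}) (enum_val e))
  lt_coord.
(* There are finitely many charts, so one product vanishes on all of them. *)
exists (\prod_J Q J) => [|Lam v /feasible_in_chart FLam /FLam[J [x vE]]].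
  by apply/prodf_neq0 => J _.
rewrite rmorph_prod; apply/eqP/prodf_eq0; exists (finfun J : charts) => //=.
rewrite -[X in _ == X](QE (finfun J) (x \o enum_val)); apply/eqP/meval_eq => e.
rewrite rmorph_chart (_ : _ \o _ = x); last first.
  by apply/funext => p; rewrite /= mevalXU /= enum_rankK.
by rewrite /entries; case: (enum_val e) => c [r k] /=; rewrite vE /chart ffunE.
Qed.

(** * From points of the affine space of entries back to configurations *)

Definition frames_of_entries (w : 'I_#|entry L| -> F) : frames F L :=
  fun c => [tuple \row_k w (enum_rank (existT _ c (r, k) : entry L))
             | r < (tag c).+1].

Lemma entries_of_entries w : entries (frames_of_entries w) =1 w.
Proof.
move=> e; rewrite /entries tnth_mktuple mxE; congr w.
by rewrite -[RHS]enum_valK; case: (enum_val e) => c [].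
Qed.

(** [D] is the maximal minor on the first columns. It is a nonzero polynomial because it equals 1
    when the rows are the first standard basis vectors. *)
Lemma free_relation (c : component L) :
  exists2 D : {mpoly F[#|entry L|]}, D != 0 &
    forall w, D.@[w] != 0 -> free (frames_of_entries w c).
Proof.
have le_tag : ((tag c).+1 <= n.+1)%N.
  by have := ltn_ord (tag c); move: (tag c : nat); lia.
pose pid (S : comNzRingType) := pid_mx (tag c).+1 : 'M[S]_(n.+1, (tag c).+1).
pose rows (S : comNzRingType) (x : entry L -> S) : 'M_((tag c).+1, n.+1) :=
  \matrix_(r, k) x (existT _ c (r, k)).
pose X e : {mpoly F[#|entry L|]} := 'X_(enum_rank e).
have evalD w : (\det (rows _ X *m pid _)).@[w]
    = \det (rows _ (fun e => w (enum_rank e)) *m pid F).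
  rewrite -det_map_mx map_mxM map_pid_mx; congr (\det (_ *m _)).
  by apply/matrixP => r k; rewrite !mxE /X /= mevalXU.
exists (\det (rows _ X *m pid _)) => [|w].
  pose w (e : 'I_#|entry L|) : F :=
    ((tagged (enum_val e)).1 == (tagged (enum_val e)).2 :> nat)%:R.
  apply/eqP => /(congr1 (meval w)); rewrite meval0 evalD.
  rewrite (_ : rows _ _ = pid_mx (tag c).+1); last first.
    by apply/matrixP => r k; rewrite !mxE /w enum_rankK /= ltn_ord andbT.
  by rewrite pid_mx_id // pid_mx_1 det1 => /eqP; rewrite oner_eq0.
rewrite evalD -unitfE => uD; apply/freeP => a a0 r.
pose ra : 'rV_(tag c).+1 := \row_r a r.
suff: ra == 0 by move/eqP/rowP/(_ r); rewrite !mxE.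
rewrite -(inj_eq (can_inj (mulmxK (uD : _ \in unitmx)))) mul0mx mulmxA.
rewrite (_ : ra *m _ = 0) ?mul0mx // mulmx_sum_row -[RHS]a0.
apply: eq_bigr => k _; rewrite mxE -tnth_nth tnth_mktuple; congr (_ *: _).
by apply/rowP => l; rewrite !mxE.
Qed.

Lemma frame_exists (Lam : configuration F L) :
  exists v : frames F L, frame_of Lam v.
Proof.
exists (fun c => tcast (eqP (valP (Lam c))) (vbasis (val (Lam c)))) => c.
by rewrite /basis_of val_tcast; exact: vbasisP.
Qed.

Lemma configuration_of_frames (v : frames F L) :
  (forall c, free (v c)) -> exists Lam : configuration F L, frame_of Lam v.
Proof.
move=> vfree.
have dimW c : \dim <<v c>>%VS == (tag c).+1.
  by rewrite (eqnP (vfree c)) size_tuple.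
exists (fun c => exist _ <<v c>>%VS (dimW c)) => c.
by rewrite /basis_of eqxx vfree.
Qed.

(** Otherwise the product of [p], defining an open part of [U], of the minors [D c] and of the
    relation [Q] is nonzero at some point. Its frames span a configuration in [U], hence a feasible
    one, where [Q] must vanish. *)
Lemma feasible_weight_bound :
  feasible_weight F L -> (#|component L| <= n.+1 ^ 2)%N.
Proof.
move=> [U [[P UP] [Lam0 ULam0] Ufeas]]; rewrite leqNgt; apply/negP.
move=> /feasible_relation[Q Q0 QE].
have [v0 v0P] := frame_exists Lam0.
have [p Pp pv0] := (UP _ _ v0P).1 ULam0.
have /fin_all_exists2[D D0 DE] c := free_relation c.
have : p * \prod_c D c * Q != 0.
  rewrite !mulf_neq0 //; last by apply/prodf_neq0 => c _.
  by apply: contra_neq pv0 => ->; rewrite meval0.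
case/mpoly_nonroot => w; rewrite !mevalM rmorph_prod !mulf_eq0 !negb_or.
case/andP=> /andP[pw /prodf_neq0 Dw] Qw; pose v := frames_of_entries w.
have [c|Lam LamP] := @configuration_of_frames v.
  by apply/DE/Dw.
have evE q : q.@[entries v] = q.@[w] by apply/meval_eq/entries_of_entries.
have /Ufeas/QE/(_ LamP) : U Lam.
  by apply/(UP _ _ LamP); exists p; rewrite ?evE.
by rewrite evE => /eqP; apply/negP.
Qed.

End Charts.

(** * Finiteness from the bound on the number of components *)

Lemma finite_bounded_weights (n b : nat) :
  finite_set [set L : weight n | (#|component L| <= b)%N]%classic.
Proof.
pose f (L : {ffun 'I_n.-1 -> 'I_b.+1}) : weight n := [ffun i => L i : nat].
apply: (@sub_finite_set _ _ (range f)) => [L /= Lb|]; last first.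
  exact: finite_image.
have Lib i : (L i < b.+1)%N.
  rewrite ltnS (leq_trans _ Lb) // card_Tagged (bigD1 i) //=.
  by rewrite card_ord leq_addr.
exists [ffun i => Ordinal (Lib i)] => //.
by apply/ffunP => i; rewrite !ffunE.
Qed.

Theorem corollary4p2 (R : realType) (n : nat) (hn : (2 <= n)%N) :
  finite_set [set L : weight n | @feasible_weight R[i] n L]%classic.
Proof.
apply: sub_finite_set (finite_bounded_weights n (n.+1 ^ 2)) => L /=.
exact: feasible_weight_bound.
Qed.
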